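(* Let $F$ be a field with $\mathrm{char}(F) \neq 2$, let $A = F[[x]]$ be the ring of formal power series over $F$, and let $K$ be the field of fractions of $A$. Let $$R = \{ r \in \mathrm{End}(A_F) : \text{there exist } q \in K \text{ and a positive integer } n \text{ with } r(a) = qa \text{ for all } a \in (x^n) \}.$$ Then the ring $R$ is $r$-clean but not clean.
   Context: All rings are associative with identity (not necessarily commutative). $\mathrm{End}(A_F)$ is the ring of $F$-linear endomorphisms of $A$ as an $F$-vector space, and $(x^n)$ is the ideal of $A$ generated by $x^n$. An element of a ring is clean if it is the sum of an idempotent and a unit; a ring is clean if each of its elements is clean. An element $r$ of a ring $S$ is regular (in the sense of von Neumann) if $r = ryr$ for some $y \in S$. An element of a ring is $r$-clean if it is the sum of a regular element and an idempotent; a ring is $r$-clean if each of its elements is $r$-clean. *)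

(* Defs.v *)
From HB Require Import structures.
From mathcomp Require Import all_boot all_algebra ring.
From mathcomp Require Import boolp.

Set Implicit Arguments.
Unset Strict Implicit.
Unset Printing Implicit Defensive.

Import GRing.Theory.
Local Open Scope ring_scope.

Section CleanRings.
Variable S : pzRingType.
Implicit Types a e u r : S.

Definition is_idempotent e := e * e = e.

Definition is_unit u := exists v, u * v = 1 /\ v * u = 1.

Definition is_regular r := exists y, r = r * y * r.

Definition is_clean a :=
  exists e u, [/\ is_idempotent e, is_unit u & a = e + u].

Definition is_r_clean a :=
  exists r e, [/\ is_regular r, is_idempotent e & a = r + e].

End CleanRings.

Definition clean_ring (S : pzRingType) := forall a : S, is_clean a.
Definition r_clean_ring (S : pzRingType) := forall a : S, is_r_clean a.

(* F[[x]]: a formal power series is the sequence of its coefficients. *)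
Record powser (F : fieldType) := PowSer { pcoef : nat -> F }.

HB.instance Definition _ (F : fieldType) := gen_eqMixin (powser F).
HB.instance Definition _ (F : fieldType) := gen_choiceMixin (powser F).

Section PowerSeries.
Variable F : fieldType.
Implicit Types a b c f g h : powser F.

Lemma powserP f g : pcoef f =1 pcoef g <-> f = g.
Proof. by split=> [|->//]; case: f g => [u] [v] /= /funext ->. Qed.

Definition ps_zero : powser F := PowSer (fun=> 0).
Definition ps_opp f := PowSer (fun i => - pcoef f i).
Definition ps_add f g := PowSer (fun i => pcoef f i + pcoef g i).

Fact ps_addA : associative ps_add.
Proof. by move=> f g h; apply/powserP => i /=; rewrite addrA. Qed.
Fact ps_addC : commutative ps_add.
Proof. by move=> f g; apply/powserP => i /=; rewrite addrC. Qed.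
Fact ps_add0 : left_id ps_zero ps_add.
Proof. by move=> f; apply/powserP => i /=; rewrite add0r. Qed.
Fact ps_addN : left_inverse ps_zero ps_opp ps_add.
Proof. by move=> f; apply/powserP => i /=; rewrite addNr. Qed.

HB.instance Definition _ :=
  GRing.isZmodule.Build (powser F) ps_addA ps_addC ps_add0 ps_addN.

Definition ps_one : powser F := PowSer (fun i => (i == 0)%:R).
Definition ps_mul f g : powser F :=
  PowSer (fun i => \sum_(j < i.+1) pcoef f j * pcoef g (i - j)).

Fact ps_mulE f g i :
  pcoef (ps_mul f g) i = \sum_(j < i.+1) pcoef f j * pcoef g (i - j).
Proof. by []. Qed.

Fact ps_mul_rev f g i :
  pcoef (ps_mul f g) i = \sum_(j < i.+1) pcoef f (i - j) * pcoef g j.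
Proof.
rewrite /= (reindex_inj rev_ord_inj) /=.
by apply: eq_bigr => j _; rewrite (sub_ordK j).
Qed.

Fact ps_mulA : associative ps_mul.
Proof.
move=> f g h; apply/powserP=> i; rewrite ps_mulE ps_mul_rev.
pose coef3 j k := pcoef f j * (pcoef g (i - j - k) * pcoef h k).
transitivity (\sum_(j < i.+1) \sum_(k < i.+1 | (k <= i - j)%N) coef3 j k).
  apply: eq_bigr => j _; rewrite ps_mul_rev big_distrr /=.
  by rewrite (big_ord_narrow_leq (leq_subr _ _)).
rewrite (exchange_big_dep predT) //; apply: eq_bigr => k _.
transitivity (\sum_(j < i.+1 | (j <= i - k)%N) coef3 j k).
  apply: eq_bigl => j; rewrite -ltnS -(ltnS j) -!subSn ?leq_ord //.
  by rewrite -subn_gt0 -(subn_gt0 j) -!subnDA addnC.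
rewrite (big_ord_narrow_leq (leq_subr _ _)) ps_mulE big_distrl /=.
by apply: eq_bigr => j _; rewrite /coef3 -!subnDA addnC mulrA.
Qed.

Fact ps_mulC : commutative ps_mul.
Proof.
move=> f g; apply/powserP=> i; rewrite ps_mul_rev /=.
by apply: eq_bigr => j _; rewrite mulrC.
Qed.

Fact ps_mul1 : left_id ps_one ps_mul.
Proof.
move=> f; apply/powserP=> i /=; rewrite big_ord_recl subn0 mul1r.
by rewrite big1 ?addr0 // => j _; rewrite mul0r.
Qed.

Fact ps_mulDl : left_distributive ps_mul +%R.
Proof.
move=> f g h; apply/powserP=> i /=; rewrite -big_split.
by apply: eq_bigr => j _; rewrite mulrDl.
Qed.

Fact ps_one_neq0 : ps_one != 0.
Proof.
by apply/eqP=> /powserP/(_ 0%N) /eqP; rewrite /= oner_eq0.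
Qed.

HB.instance Definition _ := GRing.Zmodule_isComNzRing.Build (powser F)
  ps_mulA ps_mulC ps_mul1 ps_mulDl ps_one_neq0.

Definition ps_scale (k : F) f := PowSer (fun i => k * pcoef f i).

Fact ps_scaleA k l f : ps_scale k (ps_scale l f) = ps_scale (k * l) f.
Proof. by apply/powserP => i /=; rewrite mulrA. Qed.
Fact ps_scale1 : left_id 1 ps_scale.
Proof. by move=> f; apply/powserP => i /=; rewrite mul1r. Qed.
Fact ps_scaleDr : right_distributive ps_scale +%R.
Proof. by move=> k f g; apply/powserP => i /=; rewrite mulrDr. Qed.
Fact ps_scaleDl f : {morph ps_scale^~ f : k l / k + l}.
Proof. by move=> k l; apply/powserP => i /=; rewrite mulrDl. Qed.

HB.instance Definition _ := GRing.Zmodule_isLmodule.Build F (powser F)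
  ps_scaleA ps_scale1 ps_scaleDr ps_scaleDl.

Lemma pcoefM f g i :
  pcoef (f * g) i = \sum_(j < i.+1) pcoef f j * pcoef g (i - j).
Proof. by []. Qed.

Lemma pcoef1 i : pcoef (1 : powser F) i = (i == 0)%:R.
Proof. by []. Qed.

Definition ps_unit : {pred powser F} := fun f => pcoef f 0 != 0.

(* The first n coefficients of the inverse of a series with nonzero constant
   term, by the usual recursion. *)
Fixpoint ps_inv_seq (u : nat -> F) n : seq F :=
  if n is m.+1 then
    let s := ps_inv_seq u m in
    rcons s (((m == 0)%:R - \sum_(i < m) s`_i * u (m - i)%N) / u 0)
  else [::].

Definition ps_inv f : powser F :=
  if f \in ps_unit then PowSer (fun n => (ps_inv_seq (pcoef f) n.+1)`_n) else f.

Lemma size_ps_inv_seq u n : size (ps_inv_seq u n) = n.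
Proof. by elim: n => //= n IHn; rewrite size_rcons IHn. Qed.

Lemma nth_ps_inv_seq u n i :
  (i < n)%N -> (ps_inv_seq u n)`_i = (ps_inv_seq u i.+1)`_i.
Proof.
elim: n => // n IHn; rewrite ltnS leq_eqVlt => /predU1P[-> //|lt_in].
by rewrite [LHS]/= nth_rcons size_ps_inv_seq lt_in IHn.
Qed.

Fact ps_mulV : {in ps_unit, left_inverse 1 ps_inv *%R}.
Proof.
move=> f uf; apply/powserP => n; rewrite pcoefM pcoef1 /ps_inv uf.
rewrite big_ord_recr subnn [pcoef _ n]/= nth_rcons size_ps_inv_seq ltnn eqxx.
rewrite divfK //; set s := \sum_(i < n) (_`_i * _); set t := \sum_i _.
suff -> : t = s by rewrite /= addrC subrK.
by apply: eq_bigr => i _; rewrite nth_ps_inv_seq.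
Qed.

Fact ps_unitPl f g : g * f = 1 -> ps_unit f.
Proof.
move/powserP/(_ 0%N); rewrite pcoefM pcoef1 big_ord1 => /= gf1.
by apply/eqP => f0; move/eqP: gf1; rewrite f0 mulr0 eq_sym oner_eq0.
Qed.

Fact ps_inv_out : {in [predC ps_unit], ps_inv =1 id}.
Proof. by move=> f; rewrite inE /ps_inv => /negbTE ->. Qed.

HB.instance Definition _ := GRing.ComNzRing_hasMulInverse.Build (powser F)
  ps_mulV ps_unitPl ps_inv_out.

Definition psX : powser F := PowSer (fun i => (i == 1)%:R).

Lemma pcoefXM f i : pcoef (psX * f) i = if i is j.+1 then pcoef f j else 0.
Proof.
rewrite pcoefM; case: i => [|j]; first by rewrite big_ord1 /= mul0r.
rewrite !big_ord_recl /= big1 => [|k _]; last by rewrite mul0r.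
by rewrite mul0r add0r mul1r addr0 /bump /= subSS subn0.
Qed.

Lemma pcoefXnM n f i :
  pcoef (psX ^+ n * f) i = if (i < n)%N then 0 else pcoef f (i - n).
Proof.
elim: n i => [|n IHn] i; first by rewrite mul1r subn0.
by rewrite exprS -mulrA pcoefXM; case: i => // i; rewrite IHn.
Qed.

Lemma psXnM_eq0 n f : psX ^+ n * f = 0 -> f = 0.
Proof.
move/powserP => Xf0; apply/powserP => i; have := Xf0 (n + i)%N.
by rewrite pcoefXnM ltnNge leq_addr /= addKn.
Qed.

Lemma ps_factor f :
  f != 0 -> exists n g, f = psX ^+ n * g /\ g \is a GRing.unit.
Proof.
move=> nz_f; have exf : exists i, pcoef f i != 0.
  apply: contrapT => /forallNP f0; case/eqP: nz_f; apply/powserP => i.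
  by apply/eqP/negP => /negP/f0.
case: (ex_minnP exf) => n nz_fn min_n.
exists n, (PowSer (fun i => pcoef f (n + i))); split.
  apply/powserP => i; rewrite pcoefXnM; case: ltnP => [lt_in|/subnKC /= -> //].
  by apply/eqP; apply: contraTT lt_in => /min_n; rewrite -leqNgt.
by rewrite -[_ \is a _]/(pcoef f (n + 0) != 0) addn0.
Qed.

Fact ps_idomain : GRing.integral_domain_axiom (powser F).
Proof.
move=> f g fg0; case: eqVneq => //= /ps_factor[n [h [def_f uh]]].
by move: fg0; rewrite def_f -mulrA => /psXnM_eq0/eqP; rewrite mulrI_eq0 //;
  exact: mulrI.
Qed.

HB.instance Definition _ :=
  GRing.ComUnitRing_isIntegral.Build (powser F) ps_idomain.

Lemma psX_neq0 : psX != 0.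
Proof. by apply/eqP => /powserP/(_ 1%N)/eqP; rewrite /= oner_eq0. Qed.

(* Membership in the ideal (x^n), principal as F[[x]] is commutative. *)
Definition in_psX_ideal n a := exists b, a = psX ^+ n * b.

End PowerSeries.

(* End(V_k), with composition as product. *)
Definition lendo (k : pzRingType) (V : lmodType k) := {linear V -> V}.

HB.instance Definition _ (k : pzRingType) (V : lmodType k) :=
  gen_eqMixin (lendo V).
HB.instance Definition _ (k : pzRingType) (V : lmodType k) :=
  gen_choiceMixin (lendo V).

Section LinearEndo.
Variables (k : pzRingType) (V : lmodType k).
Implicit Types r s t : lendo V.

Lemma lendoP r s : (r : V -> V) =1 s <-> r = s.
Proof.
split=> [|->//]; case: r s => r [[r1] [r2]] [s [[s1] [s2]]] /=.
move/funext => rs; case: s / rs s1 s2 => s1 s2.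
by rewrite (Prop_irrelevance r1 s1) (Prop_irrelevance r2 s2).
Qed.

Definition lendo_zero : lendo V := (\0 : V -> V).
Definition lendo_opp r : lendo V := (\- r : V -> V).
Definition lendo_add r s : lendo V := (r \+ s : V -> V).
Definition lendo_one : lendo V := (idfun : V -> V).
Definition lendo_mul r s : lendo V := (r \o s : V -> V).

Fact lendo_addA : associative lendo_add.
Proof. by move=> r s t; apply/lendoP => v /=; rewrite addrA. Qed.
Fact lendo_addC : commutative lendo_add.
Proof. by move=> r s; apply/lendoP => v /=; rewrite addrC. Qed.
Fact lendo_add0 : left_id lendo_zero lendo_add.
Proof. by move=> r; apply/lendoP => v /=; rewrite add0r. Qed.
Fact lendo_addN : left_inverse lendo_zero lendo_opp lendo_add.
Proof. by move=> r; apply/lendoP => v /=; rewrite addNr. Qed.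

HB.instance Definition _ := GRing.isZmodule.Build (lendo V)
  lendo_addA lendo_addC lendo_add0 lendo_addN.

Fact lendo_mulA : associative lendo_mul.
Proof. by move=> r s t; apply/lendoP. Qed.
Fact lendo_mul1l : left_id lendo_one lendo_mul.
Proof. by move=> r; apply/lendoP. Qed.
Fact lendo_mul1r : right_id lendo_one lendo_mul.
Proof. by move=> r; apply/lendoP. Qed.
Fact lendo_mulDl : left_distributive lendo_mul +%R.
Proof. by move=> r s t; apply/lendoP. Qed.
Fact lendo_mulDr : right_distributive lendo_mul +%R.
Proof. by move=> r s t; apply/lendoP => v; apply: raddfD. Qed.

HB.instance Definition _ := GRing.Zmodule_isPzRing.Build (lendo V)
  lendo_mulA lendo_mul1l lendo_mul1r lendo_mulDl lendo_mulDr.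

Lemma lendo_oneE v : (1 : lendo V) v = v. Proof. by []. Qed.
Lemma lendo_addE r s v : (r + s) v = r v + s v. Proof. by []. Qed.
Lemma lendo_oppE r v : (- r) v = - r v. Proof. by []. Qed.
Lemma lendo_mulE r s v : (r * s) v = r (s v). Proof. by []. Qed.

End LinearEndo.

Section EventualMultiplications.
Variable F : fieldType.
Local Notation A := (powser F).
Local Notation K := {fraction A}.
Local Notation tofrac := (@FracField.tofrac A).

(* r acts on some ideal (x^n) as multiplication by an element q of K; the
   equation r(a) = q a is read in K, through the embedding of A. *)
Definition evmul_pred : {pred lendo A} := fun r =>
  `[< exists (q : K) (n : nat), (0 < n)%N /\
        forall a : A, in_psX_ideal n a -> tofrac (r a) = q * tofrac a >].

Lemma evmulP (r : lendo A) :
  reflect (exists (q : K) (n : nat), (0 < n)%N /\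
             forall a : A, in_psX_ideal n a -> tofrac (r a) = q * tofrac a)
          (r \in evmul_pred).
Proof. exact: asboolP. Qed.

Lemma in_psX_ideal_le m n (a : A) :
  (m <= n)%N -> in_psX_ideal n a -> in_psX_ideal m a.
Proof.
move=> le_mn [b ->]; exists (psX F ^+ (n - m) * b).
by rewrite mulrA -exprD subnKC.
Qed.

Lemma frac_denom (q : K) : exists (d c : A), d != 0 /\ q * tofrac d = tofrac c.
Proof.
elim/quotW: q => x; exists x.2, x.1; split; first exact: denom_ratioP.
unlock FracField.tofrac; rewrite -[LHS]FracField.pi_mul.
apply/eqmodP; rewrite /= FracField.equivfE /FracField.mulf.
rewrite !numden_Ratio ?mulr1 ?oner_neq0 ?denom_ratioP //.
by rewrite mulrC.
Qed.

Lemma psX_denom (q : K) :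
  exists m (c : A), q * tofrac (psX F ^+ m) = tofrac c.
Proof.
have [d [c [/ps_factor[m [u [-> Uu]]] dq]]] := frac_denom q.
by exists m, (c / u); rewrite tofracM -dq -mulrA -tofracM mulrK.
Qed.

Fact evmul_subring_closed : subring_closed evmul_pred.
Proof.
split=> [|r s|r s].
- by apply/evmulP; exists 1, 1%N; split=> // a _; rewrite mul1r.
- move=> /evmulP[q [m [m_gt0 rq]]] /evmulP[p [n [n_gt0 sp]]].
  apply/evmulP; exists (q - p), (maxn m n); split=> [|a a_mn].
    by rewrite leq_max m_gt0.
  rewrite lendo_addE lendo_oppE tofracB mulrBl rq ?sp //.
    exact: in_psX_ideal_le (leq_maxr m n) a_mn.
  exact: in_psX_ideal_le (leq_maxl m n) a_mn.
move=> /evmulP[q [m [m_gt0 rq]]] /evmulP[p [n [n_gt0 sp]]].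
have [k [c def_c]] := psX_denom p.
apply/evmulP; exists (q * p), (n + (k + m))%N; split=> [|_ [b ->]].
  by rewrite ltn_addr.
have psb : tofrac (s (psX F ^+ (n + (k + m)) * b)) =
           p * tofrac (psX F ^+ (n + (k + m)) * b).
  by apply: sp; apply: in_psX_ideal_le (leq_addr _ _) _; exists b.
rewrite lendo_mulE -mulrA -psb rq //; exists (c * psX F ^+ n * b).
apply/eqP; rewrite -tofrac_eq psb !exprD !tofracM -def_c; apply/eqP.
by ring.
Qed.

HB.instance Definition _ :=
  GRing.isSubringClosed.Build (lendo A) evmul_pred evmul_subring_closed.

(* The ring R, as a subring of End(A_F). *)
Record evmul := EvMul { evmul_val :> lendo A; _ : evmul_val \in evmul_pred }.

HB.instance Definition _ := [isSub for evmul_val].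
HB.instance Definition _ := [Choice of evmul by <:].
HB.instance Definition _ := GRing.SubChoice_isSubPzRing.Build (lendo A)
  evmul_pred evmul evmul_subring_closed.

End EventualMultiplications.

(* Main.v *)
(** An endomorphism [r] lies in [R] iff [r (x^n b) = w b] for some [n] and some
    power series [w].  If [w <> 0], write [w = x^m g] with [g] a unit: along
    the decompositions [A = F^n + x^n A] of the source and [A = F^m + x^m A] of
    the target, [r] is block triangular with an invertible infinite block, so a
    generalized inverse of its finite block extends to one of [r] in [R].  Thus
    [r] is regular when [w <> 0]; when [w = 0] it is [r - 1] that is regular,
    and in both cases [r] is r-clean.

    The backward shift [s] is not clean.  An idempotent acts far out as [0] or
    [1], so if [s - e] were a unit it would map [x^(n+1) A] onto [x^n A] for
    some [n], and hence embed [A / x^(n+1) A] into [A / x^n A]. *)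
Require Import Defs.
From HB Require Import structures.
From mathcomp Require Import all_boot all_algebra.

Set Implicit Arguments.
Unset Strict Implicit.
Unset Printing Implicit Defensive.

Import GRing.Theory.

Section EventualMultiplications.
Local Open Scope ring_scope.
Variable F : fieldType.
Local Notation A := (powser F).
Local Notation X := (psX F).

Lemma powserMZr (k : F) (f g : A) : f * (k *: g) = k *: (f * g).
Proof.
apply/powserP => i; rewrite pcoefM /= mulr_sumr.
by apply: eq_bigr => j _; rewrite mulrCA.
Qed.

Definition trunc n (a : A) : 'rV[F]_n := \row_i pcoef a i.

Definition embed n (v : 'rV[F]_n) : A :=
  PowSer (fun i => if insub i is Some j then v 0 j else 0).

Definition ps_drop n (a : A) : A := PowSer (fun i => pcoef a (n + i)).

Fact trunc_is_linear n : linear (@trunc n).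
Proof. by move=> k a b; apply/rowP => i; rewrite !mxE. Qed.
HB.instance Definition _ n :=
  GRing.isLinear.Build F A 'rV[F]_n _ (@trunc n) (@trunc_is_linear n).

Fact embed_is_linear n : linear (@embed n).
Proof.
move=> k a b; apply/powserP => i /=.
by case: insub => [j|]; rewrite ?mxE // mulr0 addr0.
Qed.
HB.instance Definition _ n :=
  GRing.isLinear.Build F 'rV[F]_n A _ (@embed n) (@embed_is_linear n).

Fact ps_drop_is_linear n : linear (@ps_drop n).
Proof. by move=> k a b; apply/powserP. Qed.
HB.instance Definition _ n :=
  GRing.isLinear.Build F A A _ (@ps_drop n) (@ps_drop_is_linear n).

Lemma trunc_embed n : cancel (@embed n) (@trunc n).
Proof. by move=> v; apply/rowP => i; rewrite mxE /= valK. Qed.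

Lemma trunc_XnM n (a : A) : trunc n (X ^+ n * a) = 0.
Proof. by apply/rowP => i; rewrite !mxE pcoefXnM ltn_ord. Qed.

Lemma truncK n (a : A) : embed (trunc n a) + X ^+ n * ps_drop n a = a.
Proof.
apply/powserP => i; rewrite -[LHS]/(_ + pcoef (_ * _) i) pcoefXnM /=.
case: insubP => [j lt_in ji|ge_in]; first by rewrite lt_in mxE ji addr0.
by rewrite (negbTE ge_in) add0r subnKC // leqNgt.
Qed.

Lemma trunc_eq0 n (a : A) : trunc n a = 0 -> a = X ^+ n * ps_drop n a.
Proof. by move=> a0; rewrite -{1}[a](truncK n) a0 linear0 add0r. Qed.

Lemma ps_dropXnM n (a : A) : ps_drop n (X ^+ n * a) = a.
Proof.
by apply/powserP => i; rewrite -[LHS]/(pcoef _ (n + i)) pcoefXnM ltnNge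
  leq_addr addKn.
Qed.

(** The fraction and the series determine each other: [w] is [r (x^n)], and [q] is [w / x^n]. *)
Lemma evmul_predP (r : lendo A) :
  (r \in @evmul_pred F) <-> exists n w, forall b, r (X ^+ n * b) = w * b.
Proof.
split=> [/evmulP[q [n [_ rq]]] | [n [w rw]]].
  exists n, (r (X ^+ n)) => b; apply/eqP; rewrite -tofrac_eq tofracM.
  rewrite !rq ?tofracM ?mulrA //; last by exists b.
  by exists 1; rewrite mulr1.
(* Here [n] may be [0]; passing to [n.+1] makes the exponent positive. *)
apply/evmulP; exists (FracField.tofrac w / FracField.tofrac (X ^+ n)), n.+1.
split=> // _ [b ->]; rewrite exprSr -mulrA rw !tofracM [RHS]mulrA divfK //.
by rewrite tofrac_eq0 expf_neq0 // psX_neq0.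
Qed.

Section GeneralizedInverse.
Variables (r : lendo A) (n m : nat) (g : A).

(** When [r] maps [x^n A] into [x^m A], this matrix, acting on row vectors, is the induced map from
    [A / x^n A] to [A / x^m A]. *)
Definition finite_block : 'M[F]_(n, m) :=
  lin1_mx (@trunc m \o r \o @embed n).

Definition finite_part_inv (a : A) : A :=
  embed (trunc m a *m pinvmx finite_block).

(** For [a] in the image of [r], the first summand solves [r y = a] modulo [x^m]; the second removes
    the error, which lies in [x^m A], by inverting [x^n b |-> x^m g b]. *)
Definition gen_inv (a : A) : A :=
  finite_part_inv a +
  X ^+ n * (g^-1 * ps_drop m (a - r (finite_part_inv a))).

Fact finite_part_inv_is_linear : linear finite_part_inv.
Proof.
by move=> k a b; rewrite /finite_part_inv linearP mulmxDl -scalemxAl linearP.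
Qed.
HB.instance Definition _ :=
  GRing.isLinear.Build F A A _ finite_part_inv finite_part_inv_is_linear.

Fact gen_inv_is_linear : linear gen_inv.
Proof.
move=> k a b; rewrite /gen_inv.
have -> : k *: a + b - r (finite_part_inv (k *: a + b)) =
    k *: (a - r (finite_part_inv a)) + (b - r (finite_part_inv b)).
  by rewrite (linearP finite_part_inv) (linearP r) opprD addrACA scalerBr.
rewrite (linearP finite_part_inv) (linearP (@ps_drop m)).
by rewrite !mulrDr !powserMZr scalerDr addrACA.
Qed.
HB.instance Definition _ :=
  GRing.isLinear.Build F A A _ gen_inv gen_inv_is_linear.

Definition gen_inv_lendo : lendo A := GRing.Linear.clone F A A _ gen_inv _.

Hypothesis rw : forall b, r (X ^+ n * b) = X ^+ m * g * b.
Hypothesis Ug : g \is a GRing.unit.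

Lemma trunc_finite_block (a : A) : trunc m (r a) = trunc n a *m finite_block.
Proof.
rewrite -{1}[a](truncK n) linearD rw -mulrA linearD /= trunc_XnM addr0.
by rewrite mul_rV_lin1.
Qed.

Lemma gen_invK : r = r * gen_inv_lendo * r.
Proof.
apply/lendoP => a; rewrite !lendo_mulE -[gen_inv_lendo _]/(gen_inv _).
set c := r a; rewrite linearD rw -mulrA mulVKr //.
have tc : trunc m (c - r (finite_part_inv c)) = 0.
  rewrite linearB /= !trunc_finite_block trunc_embed /c trunc_finite_block.
  (* The truncation of [c] lies in the row space of [finite_block], where [pinvmx] gives true
     preimages. *)
  by rewrite mulmxKpV ?submx_refl ?subrr // submxMl.
by rewrite -(trunc_eq0 tc) addrC subrK.
Qed.

(** On [x^m A] the finite part vanishes, which leaves multiplication by [x^n g^-1 / x^m]. *)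
Lemma gen_inv_evmul : gen_inv_lendo \in @evmul_pred F.
Proof.
apply/evmul_predP; exists m, (X ^+ n * g^-1) => b.
rewrite -[LHS]/(gen_inv _) /gen_inv.
have -> : finite_part_inv (X ^+ m * b) = 0.
  by rewrite /finite_part_inv trunc_XnM mul0mx linear0.
by rewrite linear0 subr0 add0r ps_dropXnM mulrA.
Qed.

End GeneralizedInverse.

Lemma evmul_regular (r : evmul F) n w :
  w != 0 -> (forall b, (r : lendo A) (X ^+ n * b) = w * b) -> is_regular r.
Proof.
move=> /ps_factor[m [g [-> Ug]]] rw.
exists (EvMul (gen_inv_evmul r n m g)); apply: val_inj.
by rewrite !rmorphM /=; apply: gen_invK rw Ug.
Qed.

Lemma evmul_r_clean : r_clean_ring (evmul F).
Proof.
move=> r; have [n [w rw]] := (evmul_predP _).1 (valP r).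
have [w0 | nz_w] := eqVneq w 0; last first.
  exists r, 0; split; rewrite ?addr0 //; first exact: evmul_regular rw.
  exact: mulr0.
exists (r - 1), 1; split; [|exact: mulr1|by rewrite subrK].
(* Where [r] vanishes, [r - 1] is minus the identity. *)
apply: (@evmul_regular _ n (- X ^+ n)).
  by rewrite oppr_eq0 expf_neq0 // psX_neq0.
by move=> b; rewrite -[LHS]/(val r _ - _) rw w0 mul0r sub0r mulNr.
Qed.

(** The block of [u] has [n.+1] rows and [n] columns, so some [v != 0] has [u (embed v)] in [x^n A].
    This value is also attained on [x^(n+1) A], which does not contain [embed v]. *)
Lemma lendo_not_injective (u : lendo A) n g :
  g \is a GRing.unit -> (forall b, u (X ^+ n.+1 * b) = X ^+ n * g * b) ->
  ~ injective u.
Proof.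
move=> Ug uX inj_u; pose M := finite_block u n.+1 n.
have /rowV0Pn[v /sub_kermxP vM nz_v] : kermx M != 0.
  by rewrite kermx_eq0 /row_free neq_ltn ltnS rank_leq_col.
have /trunc_eq0 uv : trunc n (u (embed v)) = 0.
  by rewrite (trunc_finite_block uX) trunc_embed.
move/eqP: nz_v; apply; rewrite -[v]trunc_embed.
have -> : embed v = X ^+ n.+1 * (g^-1 * ps_drop n (u (embed v))).
  by apply: inj_u; rewrite uX -mulrA mulVKr.
exact: trunc_XnM.
Qed.

Definition back_shift : lendo A := GRing.Linear.clone F A A _ (@ps_drop 1) _.

Lemma back_shiftXM b : back_shift (X * b) = b.
Proof. exact: (ps_dropXnM 1). Qed.

Lemma back_shift_evmul : back_shift \in @evmul_pred F.
Proof.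
by apply/evmul_predP; exists 1%N, 1 => b; rewrite back_shiftXM mul1r.
Qed.

Lemma idempotent_evmul (e : lendo A) n w :
  e * e = e -> (forall b, e (X ^+ n * b) = w * b) -> w = 0 \/ w = X ^+ n.
Proof.
move=> ee ew; have /eqP : w * (w - X ^+ n) = 0.
  (* At [x^(2n)] the value of [e] is [w x^n], again in [x^n A], so [e] can be computed twice. *)
  have : e (e (X ^+ n * X ^+ n)) = e (X ^+ n * X ^+ n).
    by rewrite -lendo_mulE ee.
  by rewrite ew [w * _]mulrC ew mulrBr => ->; rewrite mulrC subrr.
by rewrite mulf_eq0 subr_eq0 => /orP[] /eqP; [left|right].
Qed.

Lemma evmul_not_clean : ~ clean_ring (evmul F).
Proof.
move=> /(_ (EvMul back_shift_evmul))[e [u [ee [v [_ vu]] def_s]]].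
have inj_u : injective (val u).
  by apply: (can_inj (g := val v)) => a; rewrite -lendo_mulE -rmorphM vu.
have [n [w ew]] := (evmul_predP _).1 (valP e).
(* One extra power of [x] is spent by the shift, but not by [e]. *)
have uX b : val u (X ^+ n.+1 * b) = X ^+ n * b - w * X * b.
  have -> : u = EvMul back_shift_evmul - e by rewrite def_s addrC addKr.
  rewrite -[LHS]/(back_shift _ - val e _).
  by rewrite {1}exprS -mulrA back_shiftXM exprSr -mulrA ew mulrA.
have [w0 | w1] := idempotent_evmul (congr1 val ee) ew.
  by apply: (@lendo_not_injective _ n 1 _ _ inj_u); rewrite ?unitr1 // => b;
    rewrite uX w0 !mul0r subr0 mulr1.
apply: (@lendo_not_injective _ n (1 - X) _ _ inj_u) => [|b].
  (* A series is a unit iff its constant term is nonzero. *)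
  rewrite -[_ \is a _]/(1 - 0 != 0 :> F).
  by rewrite subr0 oner_eq0.
by rewrite uX w1 mulrBr mulr1 mulrBl.
Qed.

End EventualMultiplications.

Theorem mainTheorem3 (F : fieldType) (charF : 2 \notin [pchar F]%R) :
  r_clean_ring (evmul F) /\ ~ clean_ring (evmul F).
Proof. split; [exact: evmul_r_clean | exact: evmul_not_clean]. Qed.
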